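(* Let $c\in\mathbb{C}$ be arbitrary and let $d_+=-d_-=q\,c$. Let $\mathcal{B}\subset\mathcal{A}=\mathcal{U}_q(\widehat{\mathfrak{gl}}(1|1))$ be the left coideal subalgebra generated by $k_2$, $k_0k_1^{-1}$ and $$B_0^+=\xi_0'^{+}k_0-d_+\,\xi_1^-k_0,\qquad B_0^-=\xi_0^-k_0-d_-\,\xi_1'^{+}k_0,\qquad \xi_i'^{+}=k_i^{-1}\xi_i^+.$$ Then $\mathcal{B}$ is a reflection algebra for the singlet boundary: the intertwining equation $$(T_{1/z}\otimes\epsilon)[\Delta(b)]\,K(z)=K(z)\,(T_z\otimes\epsilon)[\Delta(b)]\qquad\text{for all }b\in\mathcal{B}$$ determines a nonzero $2\times2$ matrix $K(z)$ (with entries in $\mathbb{C}(z)$), uniquely up to an overall scalar factor, and this $K(z)$ satisfies the (graded) reflection equation $$R_{21}(z/w)\,K_1(z)\,R_{12}(zw)\,K_2(w)=K_2(w)\,R_{21}(zw)\,K_1(z)\,R_{12}(z/w)$$ on $\mathcal{V}\otimes\mathcal{V}$, where $\mathcal V=\mathbb{C}^{1|1}$, $K_1=K\otimes1$, $K_2=1\otimes K$.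
   Context: $q\in\mathbb{C}^\times$ is transcendental. $\mathcal{U}_q(\widehat{\mathfrak{gl}}(1|1))$ is the Hopf superalgebra generated by odd elements $\xi_0^\pm,\xi_1^\pm$ and even invertible $k_0,k_1,k_2$ ($k_2=q^{h_2}$), with relations $k_ik_j=k_jk_i$, $k_i\xi_j^\pm k_i^{-1}=q^{\pm\hat a_{ij}}\xi_j^\pm$, $\{\xi_i^+,\xi_j^-\}=\delta_{ij}\frac{k_i-k_i^{-1}}{q-q^{-1}}$ ($i,j\in\{0,1\}$ in the last relation) and the standard Serre relations (in particular $(\xi_i^\pm)^2=0$), where $$(\hat a_{ij})_{0\le i,j\le2}=\begin{pmatrix}0&0&-2\\0&0&2\\-2&2&0\end{pmatrix}.$$ Coproduct and counit: $\Delta(k_i)=k_i\otimes k_i$, $\Delta(\xi_i^+)=\xi_i^+\otimes1+k_i\otimes\xi_i^+$, $\Delta(\xi_i^-)=\xi_i^-\otimes k_i^{-1}+1\otimes\xi_i^-$, $\epsilon(k_i)=1$, $\epsilon(\xi_i^\pm)=0$; tensor products are graded. Fundamental evaluation representation on $\mathcal V$ with basis $v_1$ (even), $v_2$ (odd): $T_z(\xi_1^+)=e_{1,2}$, $T_z(\xi_1^-)=e_{2,1}$, $T_z(\xi_0^+)=z\,e_{2,1}$, $T_z(\xi_0^-)=-z^{-1}e_{1,2}$, $T_z(k_1)=q(e_{1,1}+e_{2,2})$, $T_z(k_0)=q^{-1}(e_{1,1}+e_{2,2})$, $T_z(k_2)=q\,e_{1,1}+q^{-1}e_{2,2}$. The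 $R$-matrix, as an (even) operator on $\mathcal V\otimes\mathcal V$ in the basis $v_1\otimes v_1,v_1\otimes v_2,v_2\otimes v_1,v_2\otimes v_2$: $$R(z)=\begin{pmatrix}1&0&0&0\\0&r&1-q\,r&0\\0&1-r/q&r&0\\0&0&0&-1+(q+1/q)\,r\end{pmatrix},\qquad r=\frac{z-1}{q\,z-1/q},$$ $R_{12}=R$, and $R_{21}=PRP$ with $P$ the graded flip. All identities are identities of rational functions in $z,w$. *)

(* Defs.v *)
From HB Require Import structures.
From mathcomp Require Import all_boot all_order all_algebra.
From mathcomp Require Import boolp finmap.
From mathcomp Require Import ring.
From mathcomp.multinomials Require Import monalg.

Set Implicit Arguments.
Unset Strict Implicit.
Unset Printing Implicit Defensive.

Import GRing.Theory.

Local Open Scope ring_scope.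
Local Open Scope quotient_scope.

(* The associative unital K-algebra presented by a set X of generators and a
   set rel of elements of the free algebra K<X> (each to be set to zero): the
   quotient of K<X> by the two-sided ideal generated by rel.  It may be the
   zero ring, so it is not an algType (which is nonzero in MathComp), only a
   pzRingType and an lmodType K with pres_scaleAl and pres_scaleAr below. *)
(* Generators are locked to keep unification from unfolding the free algebra. *)
Fact pgen_key : unit. Proof. exact: tt. Qed.

Section Presentation.
Context (K : comNzRingType) (X : choiceType).
Local Notation free := {malg K[{fmonom X}]}.

Inductive gen_ideal (rel : free -> Prop) : free -> Prop :=
| gen_ideal_rel u : rel u -> gen_ideal rel u
| gen_ideal0 : gen_ideal rel 0
| gen_idealD u v : gen_ideal rel u -> gen_ideal rel v -> gen_ideal rel (u + v)
| gen_idealMl a u : gen_ideal rel u -> gen_ideal rel (a * u)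
| gen_idealMr a u : gen_ideal rel u -> gen_ideal rel (u * a).

Definition pres_ideal rel : {pred free} := fun u => `[< gen_ideal rel u >].

Context (rel : free -> Prop).

Lemma pres_idealP u : reflect (gen_ideal rel u) (u \in pres_ideal rel).
Proof. exact: asboolP. Qed.

Fact pres_ideal_zmod : zmod_closed (pres_ideal rel).
Proof.
split=> [|u v /pres_idealP Iu /pres_idealP Iv]; apply/pres_idealP.
  exact: gen_ideal0.
by apply: gen_idealD => //; rewrite -mulN1r; apply: gen_idealMl.
Qed.
HB.instance Definition _ := GRing.isZmodClosed.Build free (pres_ideal rel)
  pres_ideal_zmod.

Definition presAlg := Quotient.quot (pres_ideal rel).
HB.instance Definition _ := Choice.on presAlg.
HB.instance Definition _ := GRing.Zmodule.on presAlg.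
HB.instance Definition _ := EqQuotient.on presAlg.
HB.instance Definition _ := ZmodQuotient.on presAlg.

Lemma pres_eqP (u v : free) :
  reflect (\pi_presAlg u = \pi_presAlg v) (u - v \in pres_ideal rel).
Proof. by rewrite Quotient.idealrBE; apply: eqP. Qed.

Lemma presW (P : presAlg -> Type) : (forall u, P (\pi u)) -> forall x, P x.
Proof. by move=> Ppi x; rewrite -[x]reprK. Qed.

Definition pres_one : presAlg := lift_cst presAlg 1.
Definition pres_mul := lift_op2 presAlg *%R.
Definition pres_scale (c : K) := lift_op1 presAlg ( *:%R c).

Lemma repr_sub u : gen_ideal rel (repr (\pi_presAlg u) - u).
Proof. by apply/pres_idealP/pres_eqP; rewrite reprK. Qed.

Lemma pi_pres1 : \pi_presAlg 1 = pres_one.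
Proof. by unlock pres_one. Qed.

Lemma pi_presM u v :
  pres_mul (\pi_presAlg u) (\pi_presAlg v) = \pi_presAlg (u * v).
Proof.
unlock pres_mul; apply/pres_eqP/pres_idealP; set u' := repr _; set v' := repr _.
have -> : u' * v' - u * v = (u' - u) * v' + u * (v' - v).
  by rewrite mulrBl mulrBr addrA subrK.
by apply: gen_idealD; [apply: gen_idealMr | apply: gen_idealMl];
  apply: repr_sub.
Qed.

Lemma pi_presZ c u : pres_scale c (\pi_presAlg u) = \pi_presAlg (c *: u).
Proof.
unlock pres_scale; apply/pres_eqP/pres_idealP; rewrite -scalerBr -mul_malgC.
exact/gen_idealMl/repr_sub.
Qed.

Lemma pi_presD u v : \pi_presAlg (u + v) = \pi_presAlg u + \pi_presAlg v.
Proof. exact: raddfD. Qed.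

Fact pres_mulA : associative pres_mul.
Proof.
by elim/presW=> u; elim/presW=> v; elim/presW=> w; rewrite !pi_presM mulrA.
Qed.
Fact pres_mul1 : left_id pres_one pres_mul.
Proof. by elim/presW=> u; rewrite -pi_pres1 pi_presM mul1r. Qed.
Fact pres_mulr1 : right_id pres_one pres_mul.
Proof. by elim/presW=> u; rewrite -pi_pres1 pi_presM mulr1. Qed.
Fact pres_mulDl : left_distributive pres_mul +%R.
Proof.
elim/presW=> u; elim/presW=> v; elim/presW=> w.
by rewrite -pi_presD !pi_presM -pi_presD mulrDl.
Qed.
Fact pres_mulDr : right_distributive pres_mul +%R.
Proof.
elim/presW=> u; elim/presW=> v; elim/presW=> w.
by rewrite -pi_presD !pi_presM -pi_presD mulrDr.
Qed.
HB.instance Definition _ := GRing.Zmodule_isPzRing.Build presAlg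
  pres_mulA pres_mul1 pres_mulr1 pres_mulDl pres_mulDr.

Fact pres_scaleA a b x :
  pres_scale a (pres_scale b x) = pres_scale (a * b) x.
Proof. by elim/presW: x => u; rewrite !pi_presZ scalerA. Qed.
Fact pres_scale1 : left_id 1 pres_scale.
Proof. by elim/presW=> u; rewrite pi_presZ scale1r. Qed.
Fact pres_scaleDr : right_distributive pres_scale +%R.
Proof.
move=> c; elim/presW=> u; elim/presW=> v.
by rewrite -pi_presD !pi_presZ -pi_presD scalerDr.
Qed.
Fact pres_scaleDl x : {morph pres_scale^~ x : a b / a + b}.
Proof. by elim/presW: x => u a b; rewrite !pi_presZ -pi_presD scalerDl. Qed.
HB.instance Definition _ := GRing.Zmodule_isLmodule.Build K presAlg
  pres_scaleA pres_scale1 pres_scaleDr pres_scaleDl.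

Lemma pi1 : \pi_presAlg 1 = 1. Proof. exact: pi_pres1. Qed.
Lemma piM u v : \pi_presAlg (u * v) = \pi_presAlg u * \pi_presAlg v.
Proof. by rewrite [RHS]pi_presM. Qed.
Lemma piZ c u : \pi_presAlg (c *: u) = c *: \pi_presAlg u.
Proof. by rewrite [RHS]pi_presZ. Qed.

Lemma free_mulC c (u : free) : u * c%:MP = c *: u.
Proof.
rewrite [u]monalgE mulr_suml scaler_sumr; apply: eq_bigr => m _.
rewrite malgM_def fgmulUU malgZ_def.
rewrite -[fgscale _ _]/(c *: << u@_m *g m >>) -mul_malgC malgM_def fgmulUU.
by rewrite mulrC mulm1 mul1m.
Qed.

Lemma pres_scaleAl c (x y : presAlg) : c *: (x * y) = (c *: x) * y.
Proof.
elim/presW: x => u; elim/presW: y => v.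
by rewrite -piM -!piZ -piM -!mul_malgC mulrA.
Qed.
Lemma pres_scaleAr c (x y : presAlg) : c *: (x * y) = x * (c *: y).
Proof.
elim/presW: x => u; elim/presW: y => v; rewrite -piM -!piZ -piM -!mul_malgC.
by rewrite !mulrA free_mulC mul_malgC.
Qed.

Definition fgen : X -> free := locked_with pgen_key (fun x => << fmu x >>).
Lemma fgenE x : fgen x = << fmu x >>.
Proof. by rewrite /fgen unlock. Qed.
Definition pgen : X -> presAlg :=
  locked_with pgen_key (fun x => \pi_presAlg (fgen x)).
Lemma pgenE x : pgen x = \pi_presAlg (fgen x).
Proof. by rewrite /pgen unlock. Qed.

Lemma pres_rel u : rel u -> \pi_presAlg u = 0.
Proof.
by move=> ru; rewrite -(raddf0 \pi_presAlg); apply/pres_eqP/pres_idealP;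
  rewrite subr0; apply: gen_ideal_rel.
Qed.

(* The Z/2-grading of presAlg in which the generator x has parity par x:
   pres_homog par p a says that a is homogeneous of parity p (true = odd). *)
Inductive pres_homog (par : X -> bool) : bool -> presAlg -> Prop :=
| homog_gen x : pres_homog par (par x) (pgen x)
| homog1 : pres_homog par false 1
| homogM p r a b : pres_homog par p a -> pres_homog par r b ->
    pres_homog par (p (+) r) (a * b)
| homog0 p : pres_homog par p 0
| homogD p a b : pres_homog par p a -> pres_homog par p b ->
    pres_homog par p (a + b)
| homogZ p c a : pres_homog par p a -> pres_homog par p (c *: a).

End Presentation.

(* Evaluation of the generators in a ring S, extended along h : K -> S.  On
   presAlg rel it is computed on a representative; when h is central and f
   satisfies the relations it does not depend on that choice and is an algebra
   morphism (pres_eval_morph). *)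
Section Evaluation.
Context (K : comNzRingType) (X : choiceType) (S : pzRingType).
Local Notation free := {malg K[{fmonom X}]}.
Context (h : K -> S) (f : X -> S).

Definition free_eval (u : free) : S :=
  \sum_(m <- msupp u) h u@_m * \prod_(x <- (m : seq X)) f x.

Definition pres_eval (rel : free -> Prop) (a : presAlg rel) : S :=
  free_eval (repr a).
End Evaluation.

Section EvalTheory.
Context (K : comNzRingType) (X : choiceType) (S : pzRingType).
Local Notation free := {malg K[{fmonom X}]}.
Context (h : {rmorphism K -> S}) (f : X -> S).
Hypothesis h_central : forall c s, h c * s = s * h c.
Local Notation ev := (free_eval h f).

Lemma free_evalEw (d : {fset {fmonom X}}) (u : free) : (msupp u `<=` d)%fset ->
  ev u = \sum_(m <- d) h u@_m * \prod_(x <- (m : seq X)) f x.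
Proof.
move=> le; rewrite /free_eval (big_fset_incl _ le) => //= x xd /mcoeff_outdom ->.
by rewrite raddf0 mul0r.
Qed.

Lemma free_evalU c (m : {fmonom X}) :
  ev << c *g m >> = h c * \prod_(x <- (m : seq X)) f x.
Proof. by rewrite (free_evalEw msuppU_le) big_seq_fset1 mcoeffUU. Qed.

Lemma free_evalB : {morph ev : u v / u - v}.
Proof.
move=> u v; have le_u : (msupp u `<=` msupp u `|` msupp v)%fset.
  exact: fsubsetUl.
have le_v : (msupp v `<=` msupp u `|` msupp v)%fset by exact: fsubsetUr.
rewrite (free_evalEw le_u) (free_evalEw le_v).
rewrite (free_evalEw (msuppB_le _ _)) -sumrB.
by apply: eq_bigr => m _; rewrite mcoeffB raddfB mulrBl.
Qed.

HB.instance Definition _ :=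
  GRing.isZmodMorphism.Build free S (free_eval h f) free_evalB.

Lemma free_evalM : {morph ev : u v / u * v}.
Proof.
move=> u v; rewrite malgME raddf_sum [in RHS]/free_eval mulr_suml /=.
apply: eq_bigr => m _; rewrite raddf_sum mulr_sumr /=; apply: eq_bigr => m' _.
rewrite free_evalU rmorphM fmM big_cat /= -!mulrA; congr (_ * _).
by rewrite mulrA h_central -mulrA.
Qed.

Lemma free_evalC c : ev c%:MP = h c.
Proof. by rewrite free_evalU fm1 big_nil mulr1. Qed.

Lemma free_eval1 : ev 1 = 1.
Proof. by rewrite free_evalC rmorph1. Qed.

Lemma free_evalZ c u : ev (c *: u) = h c * ev u.
Proof. by rewrite -mul_malgC free_evalM free_evalC. Qed.

Lemma free_eval_gen x : ev (fgen K x) = f x.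
Proof. by rewrite fgenE free_evalU rmorph1 mul1r fmU big_seq1. Qed.

Context (rel : free -> Prop).
Hypothesis f_rel : forall u, rel u -> ev u = 0.
Local Notation pev := (@pres_eval K X S h f rel).

Lemma pres_eval_pi u : pev (\pi u) = ev u.
Proof.
apply/eqP; rewrite -subr_eq0 -free_evalB; apply/eqP.
elim: (repr_sub rel u) => {u} [u /f_rel //||u v _ Hu _ Hv|a u _ Hu|a u _ Hu].
- exact: raddf0.
- by rewrite raddfD /= Hu Hv addr0.
- by rewrite free_evalM Hu mulr0.
- by rewrite free_evalM Hu mul0r.
Qed.

Lemma pres_evalD : {morph pev : a b / a + b}.
Proof.
by elim/presW=> u; elim/presW=> v; rewrite -pi_presD !pres_eval_pi raddfD.
Qed.
Lemma pres_evalM : {morph pev : a b / a * b}.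
Proof.
by elim/presW=> u; elim/presW=> v; rewrite -piM !pres_eval_pi free_evalM.
Qed.
Lemma pres_eval1 : pev 1 = 1.
Proof. by rewrite -pi1 pres_eval_pi free_eval1. Qed.
Lemma pres_eval0 : pev 0 = 0.
Proof. by rewrite -(raddf0 \pi_(presAlg rel)) pres_eval_pi raddf0. Qed.
Lemma pres_evalZ c a : pev (c *: a) = h c * pev a.
Proof. by elim/presW: a => u; rewrite -piZ !pres_eval_pi free_evalZ. Qed.
Lemma pres_eval_gen x : pev (pgen rel x) = f x.
Proof. by rewrite pgenE pres_eval_pi free_eval_gen. Qed.

End EvalTheory.

Section MorphRelations.
Context (K : comNzRingType) (F : lalgType K) (S : pzRingType) (h : K -> S).
Context (ev : F -> S).
Hypothesis evB : {morph ev : u v / u - v}.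
Hypothesis evM : {morph ev : u v / u * v}.
Hypothesis evZ : forall c u, ev (c *: u) = h c * ev u.
Hypothesis ev1 : ev 1 = 1.

Let ev0 : ev 0 = 0. Proof. by rewrite -(subrr 1) evB ev1 subrr. Qed.
Let evN u : ev (- u) = - ev u. Proof. by rewrite -sub0r evB ev0 sub0r. Qed.
Let evD u v : ev (u + v) = ev u + ev v.
Proof. by rewrite -[v]opprK evB evN !opprK. Qed.
Let evS n : ev ((-1) ^+ n) = (-1) ^+ n.
Proof. by elim: n => // n IH; rewrite !exprS evM evN ev1 IH. Qed.

Lemma ev_rel1 a : ev a = 1 -> ev (a - 1) = 0.
Proof. by move=> e; rewrite evB e ev1 subrr. Qed.
Lemma ev_rel_inv a b : ev a * ev b = 1 -> ev (a * b - 1) = 0.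
Proof. by move=> e; rewrite evB evM e ev1 subrr. Qed.
Lemma ev_relM c a b : ev c = ev a * ev b -> ev (c - a * b) = 0.
Proof. by move=> e; rewrite evB evM e subrr. Qed.
Lemma ev_relL u c a b : ev u = h c * ev a + ev b -> ev (u - (c *: a + b)) = 0.
Proof. by move=> e; rewrite evB evD evZ e subrr. Qed.
Lemma ev_rel_super n a b : ev b * ev a = (-1) ^+ n * (ev a * ev b) ->
  ev (b * a - (-1) ^+ n * (a * b)) = 0.
Proof. by move=> e; rewrite evB !evM evS e subrr. Qed.
Lemma ev_rel_comm a b : ev a * ev b = ev b * ev a -> ev (a * b - b * a) = 0.
Proof. by move=> e; rewrite evB !evM e subrr. Qed.
Lemma ev_rel_conj a b d c : ev a * ev b * ev d = h c * ev b ->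
  ev (a * b * d - c *: b) = 0.
Proof. by move=> e; rewrite evB evZ !evM e subrr. Qed.
Lemma ev_rel_anti a b c d e : ev a * ev b + ev b * ev a = h c * (ev d - ev e) ->
  ev (a * b + b * a - c *: (d - e)) = 0.
Proof. by move=> E; rewrite !(evB, evD, evZ, evM) E subrr. Qed.
Lemma ev_rel_sqr a : ev a * ev a = 0 -> ev (a * a) = 0.
Proof. by rewrite evM. Qed.
End MorphRelations.

Definition alg_morph (K : comNzRingType) (X : choiceType)
    (rel : {malg K[{fmonom X}]} -> Prop) (S : pzRingType) (h : K -> S)
    (f : presAlg rel -> S) : Prop :=
  [/\ f 1 = 1, {morph f : a b / a * b} &
      forall c a b, f (c *: a + b) = h c * f a + f b].

Lemma pres_eval_morph (K : comNzRingType) (X : choiceType)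
    (rel : {malg K[{fmonom X}]} -> Prop) (S : pzRingType)
    (h : {rmorphism K -> S}) (f : X -> S) :
  (forall c s, h c * s = s * h c) ->
  (forall u, rel u -> free_eval h f u = 0) ->
  alg_morph h (pres_eval h f (rel := rel)).
Proof.
move=> hC f0; split; [exact: pres_eval1 | exact: pres_evalM |].
by move=> c a b; rewrite pres_evalD // pres_evalZ.
Qed.

Definition pres_const (K : comNzRingType) (X : choiceType)
    (rel : {malg K[{fmonom X}]} -> Prop) (c : K) : presAlg rel :=
  c *: (1 : presAlg rel).

Section PresConst.
Context (K : comNzRingType) (X : choiceType).
Context (rel : {malg K[{fmonom X}]} -> Prop).

Fact pres_const_zmod : zmod_morphism (pres_const rel).
Proof. by move=> a b; rewrite /pres_const scalerBl. Qed.
Fact pres_const_monoid : monoid_morphism (pres_const rel).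
Proof.
split=> [|a b]; first exact: scale1r.
by rewrite /pres_const -pres_scaleAl mul1r scalerA.
Qed.
HB.instance Definition _ :=
  GRing.isZmodMorphism.Build K (presAlg rel) (pres_const rel) pres_const_zmod.
HB.instance Definition _ :=
  GRing.isMonoidMorphism.Build K (presAlg rel) (pres_const rel)
    pres_const_monoid.

Lemma pres_const_central c (a : presAlg rel) :
  pres_const rel c * a = a * pres_const rel c.
Proof. by rewrite /pres_const -pres_scaleAl -pres_scaleAr mul1r mulr1. Qed.
End PresConst.

(* The graded tensor product A (x) B of two superalgebras, with homogeneous
   parts hA p and hB p: the algebra generated by a copy a (x) 1 of A and a copy
   1 (x) b of B, where the two copies supercommute; a (x) b is the product
   (a (x) 1)(1 (x) b). *)
Section GradedTensor.
Context (K : comNzRingType) (X Y : choiceType).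
Context (relX : {malg K[{fmonom X}]} -> Prop).
Context (relY : {malg K[{fmonom Y}]} -> Prop).
Local Notation A := (presAlg relX).
Local Notation B := (presAlg relY).
Context (hA : bool -> A -> Prop) (hB : bool -> B -> Prop).

Definition tens_gen : Type := (A + B)%type.
HB.instance Definition _ := Choice.on tens_gen.
Local Notation free := {malg K[{fmonom tens_gen}]}.
Definition freel (a : A) : free := fgen K (inl a : tens_gen).
Definition freer (b : B) : free := fgen K (inr b : tens_gen).

Inductive gtens_rel : free -> Prop :=
| gtens_l1 : gtens_rel (freel 1 - 1)
| gtens_lM a a' : gtens_rel (freel (a * a') - freel a * freel a')
| gtens_lL c a a' :
    gtens_rel (freel (c *: a + a') - (c *: freel a + freel a'))
| gtens_r1 : gtens_rel (freer 1 - 1)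
| gtens_rM b b' : gtens_rel (freer (b * b') - freer b * freer b')
| gtens_rL c b b' :
    gtens_rel (freer (c *: b + b') - (c *: freer b + freer b'))
| gtens_comm p r a b : hA p a -> hB r b ->
    gtens_rel (freer b * freel a - (-1) ^+ (p && r) * (freel a * freer b)).

Definition gtens := presAlg gtens_rel.
HB.instance Definition _ := Choice.on gtens.
HB.instance Definition _ := GRing.PzRing.on gtens.
HB.instance Definition _ := GRing.Lmodule.on gtens.

Definition tensl (a : A) : gtens := pgen gtens_rel (inl a).
Definition tensr (b : B) : gtens := pgen gtens_rel (inr b).
Definition tens (a : A) (b : B) : gtens := tensl a * tensr b.

(* The linear map a (x) b |-> f a * g b; it is an algebra morphism when f and g
   are, with supercommuting images (gtens_eval_morph, gtens_eval_tens). *)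
Definition gtens_eval (S : pzRingType) (h : K -> S) (f : A -> S) (g : B -> S) :
    gtens -> S :=
  pres_eval h (fun s : tens_gen => match s with inl a => f a | inr b => g b end)
    (rel := gtens_rel).

Section EvalGtens.
Context (S : pzRingType) (h : {rmorphism K -> S}) (f : A -> S) (g : B -> S).
Hypothesis h_central : forall c s, h c * s = s * h c.
Hypothesis f_morph : alg_morph h f.
Hypothesis g_morph : alg_morph h g.
Hypothesis fg_comm : forall p r a b, hA p a -> hB r b ->
  g b * f a = (-1) ^+ (p && r) * (f a * g b).

Let fg (s : tens_gen) : S := match s with inl a => f a | inr b => g b end.

Lemma gtens_eval_rel u : gtens_rel u -> free_eval h fg u = 0.
Proof.
have [f1 fM fL] := f_morph; have [g1 gM gL] := g_morph.
have eB := free_evalB h fg; have eM := free_evalM fg h_central.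
have eZ := free_evalZ fg h_central; have e1 := free_eval1 h fg.
have el a : free_eval h fg (freel a) = f a by exact: free_eval_gen.
have er b : free_eval h fg (freer b) = g b by exact: free_eval_gen.
case=> [|a a'|c a a'||b b'|c b b'|p r a b ha hb].
- by apply: ev_rel1; rewrite ?el.
- by apply: ev_relM; rewrite ?el.
- by apply: ev_relL; rewrite ?el.
- by apply: ev_rel1; rewrite ?er.
- by apply: ev_relM; rewrite ?er.
- by apply: ev_relL; rewrite ?er.
by apply: ev_rel_super; rewrite ?el ?er; auto.
Qed.

Lemma gtens_eval_morph : alg_morph h (gtens_eval h f g).
Proof. exact: (pres_eval_morph h_central gtens_eval_rel). Qed.

Lemma gtens_eval_tens a b : gtens_eval h f g (tens a b) = f a * g b.
Proof.
rewrite /gtens_eval (pres_evalM h_central gtens_eval_rel).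
by rewrite !(pres_eval_gen h_central gtens_eval_rel).
Qed.
End EvalGtens.

Let pi_sub (u v : free) : gtens_rel (u - v) -> \pi_gtens u = \pi_gtens v.
Proof. by move=> ruv; apply/pres_eqP/pres_idealP/gen_ideal_rel. Qed.

Let tenslE a : tensl a = \pi_gtens (freel a). Proof. exact: pgenE. Qed.
Let tensrE b : tensr b = \pi_gtens (freer b). Proof. exact: pgenE. Qed.

Lemma tensl1 : tensl 1 = 1.
Proof. by rewrite tenslE -[RHS]pi1; apply: pi_sub; apply: gtens_l1. Qed.
Lemma tensr1 : tensr 1 = 1.
Proof. by rewrite tensrE -[RHS]pi1; exact/pi_sub/gtens_r1. Qed.
Lemma tenslM : {morph tensl : a a' / a * a'}.
Proof. by move=> a a'; rewrite !tenslE -[RHS]piM; apply: pi_sub; apply: gtens_lM. Qed.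
Lemma tensrM : {morph tensr : a a' / a * a'}.
Proof. by move=> a a'; rewrite !tensrE -[RHS]piM; apply: pi_sub; apply: gtens_rM. Qed.
Lemma tensl_lin c a a' : tensl (c *: a + a') = c *: tensl a + tensl a'.
Proof. by rewrite !tenslE -[X in _ = X + _]piZ -[RHS]pi_presD; exact/pi_sub/gtens_lL. Qed.
Lemma tensr_lin c a a' : tensr (c *: a + a') = c *: tensr a + tensr a'.
Proof. by rewrite !tensrE -[X in _ = X + _]piZ -[RHS]pi_presD; exact/pi_sub/gtens_rL. Qed.
Lemma tens_comm p r a b : hA p a -> hB r b ->
  tensr b * tensl a = (-1) ^+ (p && r) *: (tensl a * tensr b).
Proof.
move=> ha hb; rewrite !(tenslE, tensrE) -[LHS]piM -[X in _ *: X]piM -[RHS]piZ; apply: pi_sub.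
have -> : (-1) ^+ (p && r) *: (freel a * freer b) =
   (-1) ^+ (p && r) * (freel a * freer b).
  by case: (p && r); rewrite ?expr0 ?expr1 ?scale1r ?mul1r // scaleN1r mulN1r.
exact: gtens_comm.
Qed.

Lemma tens_mul p r a b a' b' : hA p a' -> hB r b ->
  tens a b * tens a' b' = (-1) ^+ (p && r) *: tens (a * a') (b * b').
Proof.
move=> ha hb; rewrite /tens tenslM tensrM -!mulrA (mulrA (tensr b)).
by rewrite (tens_comm ha hb) -pres_scaleAl -pres_scaleAr !mulrA.
Qed.

Lemma tensDl a a' b : tens (a + a') b = tens a b + tens a' b.
Proof. by rewrite /tens -[a]scale1r tensl_lin !scale1r mulrDl. Qed.
Lemma tensDr a b b' : tens a (b + b') = tens a b + tens a b'.
Proof. by rewrite /tens -[b]scale1r tensr_lin !scale1r mulrDr. Qed.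
Lemma tens0l b : tens 0 b = 0.
Proof. by apply: (addIr (tens 0 b)); rewrite -tensDl addr0 add0r. Qed.
Lemma tens0r a : tens a 0 = 0.
Proof. by apply: (addIr (tens a 0)); rewrite -tensDr addr0 add0r. Qed.
Lemma tensZl c a b : tens (c *: a) b = c *: tens a b.
Proof.
have l0 : tensl 0 = 0.
  by apply: (addIr (tensl 0)); rewrite -{1}(scale1r (tensl 0)) -tensl_lin
    scale1r addr0 add0r.
by rewrite /tens -[c *: a]addr0 tensl_lin l0 addr0 pres_scaleAl.
Qed.
Lemma tensZr c a b : tens a (c *: b) = c *: tens a b.
Proof.
have r0 : tensr 0 = 0.
  by apply: (addIr (tensr 0)); rewrite -{1}(scale1r (tensr 0)) -tensr_lin
    scale1r addr0 add0r.
by rewrite /tens -[c *: b]addr0 tensr_lin r0 addr0 pres_scaleAr.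
Qed.
Lemma tensBl a a' b : tens (a - a') b = tens a b - tens a' b.
Proof. by rewrite -scaleN1r tensDl tensZl scaleN1r. Qed.
Lemma tensBr a b b' : tens a (b - b') = tens a b - tens a b'.
Proof. by rewrite -scaleN1r tensDr tensZr scaleN1r. Qed.
Lemma tens11 : tens 1 1 = 1.
Proof. by rewrite /tens tensl1 tensr1 mulr1. Qed.
End GradedTensor.

(* U_q(gl(1|1)^): Xi s i is xi_i^+ (s = true) or xi_i^- (s = false); Kg i and
   Kinv i are k_i and its inverse. *)
Inductive Uq_gen := Xi of bool & 'I_2 | Kg of 'I_3 | Kinv of 'I_3.

Definition Uq_gen_encode (g : Uq_gen) : (bool * 'I_2) + ('I_3 + 'I_3) :=
  match g with
  | Xi s i => inl (s, i) | Kg i => inr (inl i) | Kinv i => inr (inr i)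
  end.
Definition Uq_gen_decode (x : (bool * 'I_2) + ('I_3 + 'I_3)) : Uq_gen :=
  match x with
  | inl (s, i) => Xi s i | inr (inl i) => Kg i | inr (inr i) => Kinv i
  end.
Lemma Uq_gen_encodeK : cancel Uq_gen_encode Uq_gen_decode.
Proof. by case. Qed.
HB.instance Definition _ := Choice.copy Uq_gen (can_type Uq_gen_encodeK).

Definition Uq_parity (g : Uq_gen) : bool := if g is Xi _ _ then true else false.

Definition hat_a : 'M[int]_3 := \matrix_(i, j)
  nth 0 (nth [::] [:: [:: 0; 0; -2]; [:: 0; 0; 2]; [:: -2; 2; 0]] i) j.

Definition node (i : 'I_2) : 'I_3 := widen_ord (isT : (2 <= 3)%N) i.

Section QuantumAffine.
Context (K : fieldType) (q : K).
Local Notation free := {malg K[{fmonom Uq_gen}]}.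
Local Notation x s i := (fgen K (Xi s i)).
Local Notation k i := (fgen K (Kg i)).
Local Notation kV i := (fgen K (Kinv i)).

(* As hat_a i j = 0 for i, j in {0, 1}, every higher Serre relation among the
   xi_i^+ (or the xi_i^-) is a consequence of their squares being zero. *)
Inductive Uq_rel : free -> Prop :=
| Uq_kV i : Uq_rel (k i * kV i - 1)
| Uq_Vk i : Uq_rel (kV i * k i - 1)
| Uq_kk i j : Uq_rel (k i * k j - k j * k i)
| Uq_kx i s j : Uq_rel (k i * x s j * kV i -
    q ^ (if s then hat_a i (node j) else - hat_a i (node j)) *: x s j)
| Uq_xx i j : Uq_rel (x true i * x false j + x false j * x true i -
    ((i == j)%:R / (q - q^-1)) *: (k (node i) - kV (node i)))
| Uq_serre s i : Uq_rel (x s i * x s i).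

Definition Uq := presAlg Uq_rel.
HB.instance Definition _ := Choice.on Uq.
HB.instance Definition _ := GRing.PzRing.on Uq.
HB.instance Definition _ := GRing.Lmodule.on Uq.

Definition xi (s : bool) (i : 'I_2) : Uq := pgen Uq_rel (Xi s i).
Definition kk (i : 'I_3) : Uq := pgen Uq_rel (Kg i).
Definition kkV (i : 'I_3) : Uq := pgen Uq_rel (Kinv i).

Definition Uq_homog : bool -> Uq -> Prop := pres_homog (rel := Uq_rel) Uq_parity.

Definition UqUq := gtens Uq_homog Uq_homog.
Local Notation "a ⊗ b" := (tens Uq_homog Uq_homog a b) (at level 40).

Definition Delta_gen (g : Uq_gen) : UqUq :=
  match g with
  | Xi true i => xi true i ⊗ 1 + kk (node i) ⊗ xi true i
  | Xi false i => xi false i ⊗ kkV (node i) + 1 ⊗ xi false i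
  | Kg i => kk i ⊗ kk i
  | Kinv i => kkV i ⊗ kkV i
  end.
Definition Delta : Uq -> UqUq :=
  pres_eval (pres_const _) Delta_gen (rel := Uq_rel).

Definition counit_gen (g : Uq_gen) : K := if g is Xi _ _ then 0 else 1.
Definition counit : Uq -> K := pres_eval idfun counit_gen (rel := Uq_rel).

Lemma Uq_evalP (S : pzRingType) (h : {rmorphism K -> S}) (f : Uq_gen -> S) :
    (forall c s, h c * s = s * h c) ->
    (forall i, f (Kg i) * f (Kinv i) = 1) ->
    (forall i, f (Kinv i) * f (Kg i) = 1) ->
    (forall i j, f (Kg i) * f (Kg j) = f (Kg j) * f (Kg i)) ->
    (forall i s j, f (Kg i) * f (Xi s j) * f (Kinv i) =
       h (q ^ (if s then hat_a i (node j) else - hat_a i (node j))) *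
         f (Xi s j)) ->
    (forall i j, f (Xi true i) * f (Xi false j) +
         f (Xi false j) * f (Xi true i) =
       h ((i == j)%:R / (q - q^-1)) * (f (Kg (node i)) - f (Kinv (node i)))) ->
    (forall s i, f (Xi s i) * f (Xi s i) = 0) ->
  forall u, Uq_rel u -> free_eval h f u = 0.
Proof.
move=> hC fkV fVk fkk fkx fxx fsq u.
have eB := free_evalB h f; have eM := free_evalM f hC.
have eZ := free_evalZ f hC; have e1 := free_eval1 h f.
have eg g : free_eval h f (fgen K g) = f g := free_eval_gen h f g.
case=> [i|i|i j|i s j|i j|s i].
- by apply: ev_rel_inv; rewrite ?eg.
- by apply: ev_rel_inv; rewrite ?eg.
- by apply: ev_rel_comm; rewrite ?eg.
- by apply: ev_rel_conj; rewrite ?eg.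
- by apply: ev_rel_anti; rewrite ?eg.
by apply: ev_rel_sqr; rewrite ?eg.
Qed.

Local Notation pi := (\pi_Uq).
Let pE := (pgenE Uq_rel).
Let piB (u v : free) : pi (u - v) = pi u - pi v. Proof. exact: raddfB. Qed.
Let pi_rel u v : Uq_rel (u - v) -> pi u = pi v.
Proof. by move=> ruv; apply/pres_eqP/pres_idealP/gen_ideal_rel. Qed.

Lemma kkK i : kk i * kkV i = 1.
Proof. by rewrite /kk /kkV !pE -[LHS]piM -[RHS]pi1; exact/pi_rel/Uq_kV. Qed.
Lemma kkVK i : kkV i * kk i = 1.
Proof. by rewrite /kk /kkV !pE -[LHS]piM -[RHS]pi1; exact/pi_rel/Uq_Vk. Qed.
Lemma kkC i j : kk i * kk j = kk j * kk i.
Proof. by rewrite /kk !pE -[LHS]piM -[RHS]piM; exact/pi_rel/Uq_kk. Qed.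
Lemma kk_xi i s j : kk i * xi s j * kkV i =
  q ^ (if s then hat_a i (node j) else - hat_a i (node j)) *: xi s j.
Proof.
rewrite /kk /kkV /xi !pE -[X in X * _]piM -[LHS]piM -[RHS]piZ.
exact/pi_rel/Uq_kx.
Qed.
Lemma xi_xi i j : xi true i * xi false j + xi false j * xi true i =
  ((i == j)%:R / (q - q^-1)) *: (kk (node i) - kkV (node i)).
Proof.
rewrite /kk /kkV /xi !pE -[X in X + _]piM -[X in _ + X]piM -[LHS]pi_presD.
rewrite -[X in _ *: X]piB -[RHS]piZ; exact/pi_rel/Uq_xx.
Qed.
Lemma xi_sqr s i : xi s i * xi s i = 0.
Proof. by rewrite /xi !pE -[LHS]piM; exact/pres_rel/Uq_serre. Qed.

Lemma hat_a_node i j : hat_a (node i) (node j) = 0.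
Proof. by rewrite mxE; case: i => [[|[]]] //; case: j => [[|[]]]. Qed.

Lemma kk_xi_comm i s j : kk (node i) * xi s j = xi s j * kk (node i).
Proof.
have := kk_xi (node i) s j; rewrite hat_a_node oppr0 if_same expr0z scale1r.
by move/(congr1 ( *%R^~ (kk (node i)))); rewrite -mulrA kkVK mulr1.
Qed.
Lemma kkV_xi_comm i s j : kkV (node i) * xi s j = xi s j * kkV (node i).
Proof.
rewrite -[LHS]mulr1 -(kkK (node i)) !mulrA; congr (_ * _).
by rewrite -mulrA -kk_xi_comm mulrA kkVK mul1r.
Qed.

Lemma kk_homog i : Uq_homog false (kk i).
Proof. exact: (homog_gen _ Uq_parity (Kg i)). Qed.
Lemma kkV_homog i : Uq_homog false (kkV i).
Proof. exact: (homog_gen _ Uq_parity (Kinv i)). Qed.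
Lemma xi_homog s i : Uq_homog true (xi s i).
Proof. exact: (homog_gen _ Uq_parity (Xi s i)). Qed.
Lemma one_homog : Uq_homog false 1. Proof. exact: homog1. Qed.

Let tmul p r a b a' b' (ha : Uq_homog p a') (hb : Uq_homog r b) :
  a ⊗ b * (a' ⊗ b') = (-1) ^+ (p && r) *: ((a * a') ⊗ (b * b')).
Proof. exact: tens_mul. Qed.
Let tmul0 r a b a' b' (ha : Uq_homog false a') (hb : Uq_homog r b) :
  a ⊗ b * (a' ⊗ b') = (a * a') ⊗ (b * b').
Proof. by rewrite (tmul _ _ ha hb) scale1r. Qed.
Let tmul00 p a b a' b' (ha : Uq_homog p a') (hb : Uq_homog false b) :
  a ⊗ b * (a' ⊗ b') = (a * a') ⊗ (b * b').
Proof. by rewrite (tmul _ _ ha hb) andbF scale1r. Qed.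
Let tmul1 a b a' b' (ha : Uq_homog true a') (hb : Uq_homog true b) :
  a ⊗ b * (a' ⊗ b') = - ((a * a') ⊗ (b * b')).
Proof. by rewrite (tmul _ _ ha hb) scaleN1r. Qed.

Lemma kk_conj i j : kk i * kk j * kkV i = kk j.
Proof. by rewrite kkC -mulrA kkK mulr1. Qed.
Lemma kkV_conj i j : kk i * kkV j * kkV i = kkV j.
Proof.
have -> : kk i * kkV j = kkV j * kk i.
  rewrite -[LHS]mul1r -(kkVK j) -mulrA; congr (_ * _).
  by rewrite mulrA kkC -mulrA kkK mulr1.
by rewrite -mulrA kkK mulr1.
Qed.

Local Notation cst := (pres_const (gtens_rel Uq_homog Uq_homog)).

Lemma Delta_rel u : Uq_rel u -> free_eval cst Delta_gen u = 0.
Proof.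
have hZ c (t : UqUq) : cst c * t = c *: t.
  by rewrite /pres_const -pres_scaleAl mul1r.
have kh := kk_homog; have Vh := kkV_homog; have xh := xi_homog.
have oh := one_homog.
apply: Uq_evalP => [c t|i|i|i j|i s j|i j|s i].
- exact: pres_const_central.
- by rewrite /= (tmul0 _ _ (Vh i) (kh i)) !kkK tens11.
- by rewrite /= (tmul0 _ _ (kh i) (Vh i)) !kkVK tens11.
- by rewrite /= (tmul0 _ _ (kh i) (kh j)) (tmul0 _ _ (kh j) (kh i)) (kkC i).
- have h1 := homogM (kh i) oh; have h2 := homogM (kh i) (xh s j).
  have h3 := homogM (kh i) (Vh (node j)).
  rewrite hZ; case: s h2 => h2 /=; rewrite mulrDr mulrDl scalerDr.
    rewrite (tmul00 _ _ (xh _ _) (kh _)) (tmul0 _ _ (Vh _) h1).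
    rewrite (tmul00 _ _ (kh _) (kh _)) (tmul0 _ _ (Vh _) h2).
    by rewrite !kk_xi kk_conj mulr1 kkK tensZl tensZr.
  rewrite (tmul00 _ _ (xh _ _) (kh _)) (tmul0 _ _ (Vh _) h3).
  rewrite (tmul00 _ _ oh (kh _)) (tmul0 _ _ (Vh _) h2).
  by rewrite !kk_xi kkV_conj mulr1 kkK tensZl tensZr.
- rewrite hZ /= !mulrDl !mulrDr.
  rewrite (tmul00 _ _ (xh _ _) oh) (tmul0 _ _ oh oh).
  rewrite (tmul1 _ _ (xh _ _) (xh _ _)) (tmul0 _ _ oh (xh _ _)).
  rewrite (tmul00 _ _ (xh _ _) (Vh _)) (tmul0 _ _ (kh _) (Vh _)).
  rewrite (tmul1 _ _ (xh _ _) (xh _ _)) (tmul0 _ _ (kh _) (xh _ _)).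
  rewrite !mul1r !mulr1 kk_xi_comm kkV_xi_comm.
  set a := xi _ _; set b := xi _ _; set k := kk _; set V := kkV _.
  have -> : (a * b) ⊗ V + a ⊗ b + (- ((b * k) ⊗ (a * V)) + k ⊗ (a * b)) +
      ((b * a) ⊗ V + (b * k) ⊗ (a * V) + (- (a ⊗ b) + k ⊗ (b * a)))
    = (a * b + b * a) ⊗ V + k ⊗ (a * b + b * a).
    rewrite tensDl tensDr.
    rewrite [LHS](AC ((2*2)*(2*2)) ((1*5)*(4*8)*(2*7)*(3*6)))%AC/=.
    by rewrite addrN addNr !addr0.
  rewrite xi_xi /V; case: eqP => [<-|_]; last first.
    by rewrite mul0r !scale0r tens0l tens0r addr0.
  rewrite tensZl tensZr -scalerDr tensBl tensBr.
  congr (_ *: _). by rewrite addrC addrA subrK.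
case: s => /=; rewrite !mulrDl !mulrDr.
  rewrite (tmul00 _ _ (xh _ _) oh) (tmul0 _ _ (kh _) oh).
  rewrite (tmul1 _ _ (xh _ _) (xh _ _)) (tmul0 _ _ (kh _) (xh _ _)).
  by rewrite !xi_sqr tens0l tens0r add0r addr0 mulr1 mul1r kk_xi_comm subrr.
rewrite (tmul00 _ _ (xh _ _) (Vh _)) (tmul0 _ _ oh (Vh _)).
rewrite (tmul1 _ _ (xh _ _) (xh _ _)) (tmul0 _ _ oh (xh _ _)).
by rewrite !xi_sqr tens0l tens0r add0r addr0 mulr1 mul1r kkV_xi_comm subrr.
Qed.

Lemma counit_rel u : Uq_rel u -> free_eval idfun counit_gen u = 0.
Proof.
apply: Uq_evalP => [c t|i|i|i j|i s j|i j|s i] /=.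
- exact: mulrC.
- by rewrite mulr1.
- by rewrite mulr1.
- by [].
- by rewrite mulr0 mul0r mulr0.
- by rewrite !mulr0 addr0 subrr mulr0.
by rewrite mulr0.
Qed.

Lemma Delta_morph : alg_morph cst Delta.
Proof.
by apply: pres_eval_morph => [c t|]; [exact: pres_const_central|exact: Delta_rel].
Qed.

Lemma counit_morph : alg_morph idfun counit.
Proof.
by apply: pres_eval_morph => [c t|]; [exact: mulrC | exact: counit_rel].
Qed.

Lemma counit_odd a : Uq_homog true a -> counit a = 0.
Proof.
have [e1 eM eL] := counit_morph.
have hC (c t : K) : idfun c * t = t * idfun c by exact: mulrC.
have e0 : counit 0 = 0 := pres_eval0 hC counit_rel.
suff gen p : Uq_homog p a -> p -> counit a = 0 by move=> /gen; apply.
elim=> {p a} [g||p r a b _ IHa _ IHb|p|p a b _ IHa _ IHb|p c a _ IHa] //=.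
- rewrite /counit (pres_eval_gen hC counit_rel).
  by case: g.
- by rewrite eM; case: p IHa => [/(_ isT)->|_]; [rewrite mul0r|move/IHb->; rewrite mulr0].
- by move=> hp; rewrite -[a]scale1r eL IHa // IHb // mulr0 addr0.
by move=> hp; rewrite -[_ *: _]addr0 eL IHa // e0 mulr0 addr0.
Qed.

End QuantumAffine.

(* The evaluation representation over a field F containing K through iota; z is
   an element of F.  Row (and column) 0 stands for v_1, row 1 for v_2. *)
Section EvaluationRepresentation.
Context (K F : fieldType) (iota : {rmorphism K -> F}) (q : K) (z : F).
Local Notation e i j := (delta_mx i j : 'M[F]_2).

Definition T_k (x : F) (i : 'I_3) : 'M[F]_2 :=
  match val i with
  | 0 => x^-1 *: (e 0 0 + e 1 1)
  | 1 => x *: (e 0 0 + e 1 1)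
  | _ => x *: e 0 0 + x^-1 *: e 1 1
  end.

Definition T_gen (g : Uq_gen) : 'M[F]_2 :=
  match g with
  | Xi true i => if i == 0 then z *: e 1 0 else e 0 1
  | Xi false i => if i == 0 then - z^-1 *: e 0 1 else e 1 0
  | Kg i => T_k (iota q) i
  | Kinv i => T_k (iota q)^-1 i
  end.

Definition eval_rep : Uq q -> 'M[F]_2 := pres_eval (scalar_mx \o iota) T_gen (rel := _).

(* T_z (x) epsilon, where End(V) (x) K is identified with End(V). *)
Definition eval_rep_counit : UqUq q -> 'M[F]_2 :=
  gtens_eval (scalar_mx \o iota) eval_rep (fun a => (iota (counit a))%:M).

Hypothesis q_neq0 : q != 0.
Hypothesis q2_neq1 : q - q^-1 != 0.
Hypothesis z_neq0 : z != 0.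

Let hC c (s : 'M[F]_2) : (scalar_mx \o iota) c * s = s * (scalar_mx \o iota) c.
Proof. exact/comm_scalar_mx. Qed.

Lemma T_rel u : Uq_rel q u -> free_eval (scalar_mx \o iota) T_gen u = 0.
Proof.
have x0 : iota q != 0 by rewrite fmorph_eq0.
have x2 : iota q - (iota q)^-1 != 0 by rewrite -fmorphV -rmorphB fmorph_eq0.
have i2 (i : 'I_2) : i = 0 \/ i = 1.
  by case: i => [[|[|[]]] ?] //; [left | right]; apply: val_inj.
have i3 (i : 'I_3) : [\/ i = node 0, i = node 1 | i = ord_max].
  by case: i => [[|[|[|[]]]] ?] //; [apply: Or31 | apply: Or32 | apply: Or33];
    apply: val_inj.
have m2 (A B : 'M[F]_2) : A 0 0 = B 0 0 -> A 0 1 = B 0 1 -> A 1 0 = B 1 0 ->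
    A 1 1 = B 1 1 -> A = B.
  move=> h00 h01 h10 h11; apply/matrixP=> a b.
  by case: (i2 a) => ->; case: (i2 b) => ->.
have E i j : iota (q ^ hat_a i (node j)) = iota q ^ hat_a i (node j).
  exact: fmorphXz.
have EN i j : iota (q ^ - hat_a i (node j)) = iota q ^ - hat_a i (node j).
  exact: fmorphXz.
have e2 : iota q ^ (2 : int) = iota q * iota q by [].
have eN2 : iota q ^ (- 2 : int) = (iota q * iota q)^-1 by [].
apply: Uq_evalP => [|i|i|i j|i s j|i j|s i] //=.
- case: (i3 i) => ->; apply: m2; rewrite !mxE !big_ord_recl !big_ord0 !mxE /=;
  by rewrite ?invrK; field.
- case: (i3 i) => ->; apply: m2; rewrite !mxE !big_ord_recl !big_ord0 !mxE /=;
  by rewrite ?invrK; field.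
- case: (i3 i) => ->; case: (i3 j) => ->; apply: m2;
  rewrite !mxE !big_ord_recl !big_ord0 !mxE /=; by rewrite ?invrK; ring.
- case: s; rewrite ?E ?EN; case: (i3 i) => ->; case: (i2 j) => ->;
  rewrite !mxE /= ?opprK ?oppr0 ?expr0z ?eN2 ?e2; apply: m2;
  rewrite !mxE !big_ord_recl !big_ord0 !mxE !big_ord_recl !big_ord0 !mxE /=;
  by (rewrite ?invrK; field; rewrite ?x0 ?z_neq0).
- have d0 : T_k (iota q) (node 0) - T_k (iota q)^-1 (node 0) =
      (- (iota q - (iota q)^-1))%:M.
    by apply: m2; rewrite !mxE /= ?invrK; ring.
  have d1 : T_k (iota q) (node 1) - T_k (iota q)^-1 (node 1) =
      (iota q - (iota q)^-1)%:M.
    by apply: m2; rewrite !mxE /= ?invrK; ring.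
  have c1 : iota (1%:R / (q - q^-1)) = (iota q - (iota q)^-1)^-1.
    by rewrite div1r fmorphV rmorphB fmorphV.
  case: (i2 i) => ->; case: (i2 j) => ->; rewrite /= ?d0 ?d1 ?c1;
    rewrite ?mul0r ?rmorph0 -1?[_%:M * _]scalar_mxM ?mulrN ?mulVf //;
    apply: m2; rewrite !mxE !big_ord_recl !big_ord0 !mxE /=;
    by (field; rewrite ?x0 ?z_neq0).
by case: s; case: (i2 i) => ->; apply: m2;
  rewrite !mxE !big_ord_recl !big_ord0 !mxE /= !(mul0r, mulr0, addr0).
Qed.

Lemma eval_rep_morph : alg_morph (scalar_mx \o iota) eval_rep.
Proof. exact: (pres_eval_morph hC T_rel). Qed.

Lemma eval_rep_counit_morph :
  alg_morph (scalar_mx \o iota) eval_rep_counit /\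
  forall a b, eval_rep_counit (tens _ _ a b) = eval_rep a * (iota (counit b))%:M.
Proof.
have g_morph : alg_morph (scalar_mx \o iota)
    (fun a : Uq q => (iota (counit a))%:M : 'M[F]_2).
  have [e1 eM eL] := counit_morph q; split=> [|a b|c a b].
  - by rewrite e1 !rmorph1.
  - by rewrite eM !rmorphM.
  - by rewrite eL !(rmorphD, rmorphM).
have fg p r (a b : Uq q) : Uq_homog p a -> Uq_homog r b ->
    (iota (counit b))%:M * eval_rep a =
    (-1) ^+ (p && r) * (eval_rep a * (iota (counit b))%:M).
  case: r => _ hb; last by rewrite andbF mul1r; apply: hC.
  by rewrite (counit_odd hb) !rmorph0 mul0r !mulr0.
split; first exact: (gtens_eval_morph hC eval_rep_morph g_morph fg).
exact: (gtens_eval_tens hC eval_rep_morph g_morph fg).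
Qed.

End EvaluationRepresentation.

Section CoidealSubalgebra.
Context (K : fieldType) (q dp dm : K).
Local Notation A := (Uq q).
Local Notation k0 := (kk q (node 0)).
Local Notation k0V := (kkV q (node 0)).
Local Notation k1V := (kkV q (node 1)).
Local Notation k2 := (kk q ord_max).

Definition xi' (i : 'I_2) : A := kkV q (node i) * xi q true i.

Definition B0p : A := xi' 0 * k0 - dp *: (xi q false 1 * k0).
Definition B0m : A := xi q false 0 * k0 - dm *: (xi' 1 * k0).

Inductive gen_subalg (G : A -> Prop) : A -> Prop :=
| gen_subalg_in a : G a -> gen_subalg G a
| gen_subalg1 : gen_subalg G 1
| gen_subalgM a b : gen_subalg G a -> gen_subalg G b -> gen_subalg G (a * b)
| gen_subalgL c a b : gen_subalg G a -> gen_subalg G b ->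
    gen_subalg G (c *: a + b).

Definition Bsub : A -> Prop :=
  gen_subalg (fun a => [\/ a = k2, a = k0 * k1V, a = B0p | a = B0m]).

(* Delta S is contained in A (x) S *)
Definition left_coideal (S : A -> Prop) : Prop :=
  forall b, S b -> exists s : seq (A * A),
    (forall x, x \in s -> S x.2) /\
    Delta b = \sum_(x <- s) tens (@Uq_homog K q) (@Uq_homog K q) x.1 x.2.

End CoidealSubalgebra.

Arguments B0p {K} q dp.
Arguments B0m {K} q dm.
Arguments Bsub {K} q dp dm _.

Notation ratfun K := {fraction {poly K}}.
Notation ratfun2 K := {fraction {poly {poly K}}}.

Section RationalFunctions.
Context (K : fieldType).
Local Notation Kz := (ratfun K).
Local Notation Kzw := (ratfun2 K).

Definition constz : {rmorphism K -> Kz} := @tofrac {poly K} \o polyC.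
Definition constzw : {rmorphism K -> Kzw} :=
  @tofrac {poly {poly K}} \o (polyC \o polyC).

Definition varz : Kz := tofrac 'X.
Definition zvar : Kzw := tofrac ('X%:P).
Definition wvar : Kzw := tofrac 'X.

(* f(x), for f in K(z) and x transcendental over K (so that the denominator does
   not vanish at x) *)
Definition rat_subst (x : Kzw) (f : Kz) : Kzw :=
  (map_poly constzw (\n_(repr f))).[x] / (map_poly constzw (\d_(repr f))).[x].
End RationalFunctions.

Section GradedOperators.
Context (L : fieldType).

(* v_i (x) v_j (i, j in {0, 1}, of parity i and j) is basis vector 2 i + j *)
Definition fst4 (a : 'I_4) : 'I_2 := inord (a %/ 2).
Definition snd4 (a : 'I_4) : 'I_2 := inord (a %% 2).

(* (A (x) B)(v_k (x) v_l), where B sends v_l to v_j with a component of parity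
   j + l, which is moved past v_k *)
Definition grtens (A B : 'M[L]_2) : 'M[L]_4 := \matrix_(a, b)
  ((-1) ^+ ((snd4 a + snd4 b) * fst4 b)%N *
     A (fst4 a) (fst4 b) * B (snd4 a) (snd4 b)).

Definition grflip : 'M[L]_4 := \matrix_(a, b)
  (if (fst4 a == snd4 b) && (snd4 a == fst4 b)
   then (-1) ^+ (fst4 b * snd4 b)%N else 0).

Definition Rmx (q x : L) : 'M[L]_4 :=
  let r := (x - 1) / (q * x - q^-1) in
  \matrix_(i, j) nth 0 (nth [::]
    [:: [:: 1; 0;         0;         0];
        [:: 0; r;         1 - q * r; 0];
        [:: 0; 1 - r / q; r;         0];
        [:: 0; 0;         0;         -1 + (q + q^-1) * r]] i) j.

Definition R12 (q x : L) := Rmx q x.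
Definition R21 (q x : L) := grflip *m Rmx q x *m grflip.
Definition K1 (A : 'M[L]_2) := grtens A 1%:M.
Definition K2 (A : 'M[L]_2) := grtens 1%:M A.
End GradedOperators.

Section Reflection.
Context (K : fieldType) (q : K).

Definition intertwines (S : Uq q -> Prop) (M : 'M[ratfun K]_2) : Prop :=
  forall b, S b ->
    eval_rep_counit (constz K) (varz K)^-1 (Delta b) *m M =
    M *m eval_rep_counit (constz K) (varz K) (Delta b).

Definition reflection_eq (M : 'M[ratfun K]_2) : Prop :=
  let z := zvar K in let w := wvar K in let q' := constzw K q in
  let Mz := map_mx (rat_subst z) M in let Mw := map_mx (rat_subst w) M in
  R21 q' (z / w) *m K1 Mz *m R12 q' (z * w) *m K2 Mw =
  K2 Mw *m R21 q' (z * w) *m K1 Mz *m R12 q' (z / w).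
End Reflection.

(* Main.v *)
Require Import Defs.
From mathcomp Require Import all_boot all_order all_algebra.
From mathcomp Require Import reals complex.
From mathcomp Require Import ring.
From mathcomp.multinomials Require Import monalg.

(* The counit turns the intertwining equation into g(b) K = K f(b), where f and
   g evaluate U_q at z and 1/z.  Since k_2 acts by diag(q, 1/q) and q^2 != 1, K
   is diagonal, and B_0^+ acts by (z - c) e_21, which fixes the ratio of the
   diagonal entries; B_0^- gives the same ratio.  Clearing denominators,
   K(z) = diag(z (z - c), 1 - c z).  All factors of the reflection equation are
   of six-vertex form, so only the two off-diagonal entries of the central
   2 x 2 block have to be compared. *)

Set Implicit Arguments.
Unset Strict Implicit.
Unset Printing Implicit Defensive.

Import GRing.Theory.

Local Open Scope ring_scope.
Local Open Scope complex_scope.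

(** * Linearity of algebra morphisms out of a presented algebra *)

Section AlgebraMorphism.
Context (K : comNzRingType) (X : choiceType).
Context (rel : {malg K[{fmonom X}]} -> Prop) (S : pzRingType).
Context (h : {rmorphism K -> S}) (f : presAlg rel -> S).
Hypothesis f_morph : alg_morph h f.

Lemma alg_morphD : {morph f : a b / a + b}.
Proof.
have [_ _ fL] := f_morph => a b.
by rewrite -[a]scale1r fL rmorph1 mul1r scale1r.
Qed.

Lemma alg_morph0 : f 0 = 0.
Proof. by apply: (addIr (f 0)); rewrite -alg_morphD !add0r. Qed.

Lemma alg_morphZ c a : f (c *: a) = h c * f a.
Proof.
by have [_ _ fL] := f_morph; rewrite -[c *: a]addr0 fL alg_morph0 addr0.
Qed.

Lemma alg_morphB : {morph f : a b / a - b}.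
Proof.
by move=> a b; rewrite alg_morphD -scaleN1r alg_morphZ rmorphN1 mulN1r.
Qed.

End AlgebraMorphism.

(** * Coproducts of the generators and the left coideal property *)

Section Coideal.
Context (K : fieldType) (q : K).
Local Notation "a ⊗ b" :=
  (tens (@Uq_homog K q) (@Uq_homog K q) a b) (at level 40).
Local Notation homog := (@Uq_homog K q).
Local Notation k0 := (kk q (node 0)).
Local Notation k1V := (kkV q (node 1)).

Lemma Delta_kk i : Delta (kk q i) = kk q i ⊗ kk q i.
Proof.
exact: (pres_eval_gen (@pres_const_central _ _ _) (@Delta_rel K q) (Kg i)).
Qed.

Lemma Delta_kkV i : Delta (kkV q i) = kkV q i ⊗ kkV q i.
Proof.
exact: (pres_eval_gen (@pres_const_central _ _ _) (@Delta_rel K q) (Kinv i)).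
Qed.

Lemma Delta_xip i :
  Delta (xi q true i) = xi q true i ⊗ 1 + kk q (node i) ⊗ xi q true i.
Proof.
exact: (pres_eval_gen (@pres_const_central _ _ _) (@Delta_rel K q) (Xi true i)).
Qed.

Lemma Delta_xim i :
  Delta (xi q false i) = xi q false i ⊗ kkV q (node i) + 1 ⊗ xi q false i.
Proof.
exact: (pres_eval_gen (@pres_const_central _ _ _) (@Delta_rel K q) (Xi false i)).
Qed.

Lemma DeltaM (a b : Uq q) : Delta (a * b) = Delta a * Delta b.
Proof. by have [_ -> _] := Delta_morph q. Qed.

Lemma Delta1 : Delta (1 : Uq q) = 1.
Proof. by have [-> _ _] := Delta_morph q. Qed.

Lemma DeltaL c (a b : Uq q) : Delta (c *: a + b) = c *: Delta a + Delta b.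
Proof.
by have [_ _ ->] := Delta_morph q; rewrite /pres_const -pres_scaleAl mul1r.
Qed.

Lemma DeltaBZ c (a b : Uq q) : Delta (a - c *: b) = Delta a - c *: Delta b.
Proof. by rewrite addrC -!scaleNr DeltaL addrC. Qed.

Lemma kk_kkV i j : kk q i * kkV q j = kkV q j * kk q i.
Proof.
rewrite -[LHS]mul1r -(kkVK q j) -mulrA; congr (_ * _).
by rewrite mulrA kkC -mulrA kkK mulr1.
Qed.

Lemma tens_mul_evenl r a b a' b' : homog false a' -> homog r b ->
  a ⊗ b * (a' ⊗ b') = (a * a') ⊗ (b * b').
Proof. by move=> ha hb; rewrite (tens_mul _ _ ha hb) scale1r. Qed.

Lemma tens_mul_evenr r a b a' b' : homog r a' -> homog false b ->
  a ⊗ b * (a' ⊗ b') = (a * a') ⊗ (b * b').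
Proof. by move=> ha hb; rewrite (tens_mul _ _ ha hb) andbF scale1r. Qed.

(** The factor k_i^{-1} of [xi' q i] cancels the k_i in Delta(xi_i^+). The result has the same shape
    as the coproduct of xi_i^- k_0, so the two terms of [B0p] and of [B0m] can be merged. *)
Lemma Delta_xip_k0 i : Delta (xi' q i * k0) =
  (xi' q i * k0) ⊗ (kkV q (node i) * k0) + k0 ⊗ (xi' q i * k0).
Proof.
have kh := kk_homog q; have Vh := kkV_homog q; have xh := xi_homog q.
rewrite /xi' !DeltaM Delta_kk Delta_kkV Delta_xip mulrDr mulrDl.
rewrite (tens_mul_evenr _ _ (xh _ _) (Vh _)) (tens_mul_evenl _ _ (kh _) (Vh _)).
rewrite mulr1 kkVK (tens_mul_evenl _ _ (kh _) (Vh _)).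
by rewrite (tens_mul_evenl _ _ (kh _) (homogM (Vh _) (xh _ _))) mul1r.
Qed.

Lemma Delta_xim_k0 i : Delta (xi q false i * k0) =
  (xi q false i * k0) ⊗ (kkV q (node i) * k0) + k0 ⊗ (xi q false i * k0).
Proof.
have kh := kk_homog q; have Vh := kkV_homog q; have xh := xi_homog q.
rewrite DeltaM Delta_kk Delta_xim mulrDl (tens_mul_evenl _ _ (kh _) (Vh _)).
by rewrite (tens_mul_evenl _ _ (kh _) (xh _ _)) mul1r.
Qed.

(** The terms with left factor k_0 merge into [k0 ⊗ B0p q dp]. The other right factors are k_0^{-1}
    k_0 = 1 and k_1^{-1} k_0, so every right factor lies in [Bsub]. *)
Lemma Delta_B0p dp : Delta (B0p q dp) =
  (xi' q 0 * k0) ⊗ 1 + k0 ⊗ B0p q dp -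
    dp *: ((xi q false 1 * k0) ⊗ (k0 * k1V)).
Proof.
rewrite /B0p DeltaBZ Delta_xip_k0 Delta_xim_k0 kkVK -kk_kkV tensBr tensZr.
by rewrite scalerDr opprD -!addrA; congr (_ + (_ + _)); rewrite addrC.
Qed.

Lemma Delta_B0m dm : Delta (B0m q dm) =
  (xi q false 0 * k0) ⊗ 1 + k0 ⊗ B0m q dm -
    dm *: ((xi' q 1 * k0) ⊗ (k0 * k1V)).
Proof.
rewrite /B0m DeltaBZ Delta_xip_k0 Delta_xim_k0 kkVK -kk_kkV tensBr tensZr.
by rewrite scalerDr opprD -!addrA; congr (_ + (_ + _)); rewrite addrC.
Qed.

(* Both tensor factors are required to be homogeneous so that products of pure
   tensors only cost a sign. *)
Definition homog_coideal_at (S : Uq q -> Prop) (b : Uq q) : Prop :=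
  exists s : seq (Uq q * Uq q),
    (forall x, x \in s ->
      [/\ S x.2, exists p, homog p x.1 & exists p, homog p x.2]) /\
    Delta b = \sum_(x <- s) x.1 ⊗ x.2.

(** Induction on the generated subalgebra: the right factor of a product of pure tensors is, up to
    sign, a product of elements of the subalgebra. *)
Lemma homog_coideal_gen_subalg (G : Uq q -> Prop) :
  (forall b, G b -> homog_coideal_at (gen_subalg G) b) ->
  left_coideal (gen_subalg G).
Proof.
move=> HG b Sb; suff [s [Hs ->]] : homog_coideal_at (gen_subalg G) b.
  by exists s; split=> // x /Hs[].
elim: Sb => {b} [b Gb||a b _ [s [Hs Ea]] _ [t [Ht Eb]]
                 |c a b _ [s [Hs Ea]] _ [t [Ht Eb]]].
- exact: HG.
- exists [:: (1, 1)]; split; last by rewrite big_seq1 /= tens11 Delta1.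
  move=> x; rewrite inE => /eqP->; split; first exact: gen_subalg1.
    by exists false; apply: one_homog.
  by exists false; apply: one_homog.
- rewrite /homog_coideal_at DeltaM Ea Eb mulr_suml.
  (* One summand of [Delta a] is multiplied by the whole sum for [Delta b]; the resulting lists are
     concatenated afterwards. *)
  have tensM x : x \in s -> exists v : seq (Uq q * Uq q),
    (forall x, x \in v ->
      [/\ gen_subalg G x.2, exists p, homog p x.1 & exists p, homog p x.2]) /\
    x.1 ⊗ x.2 * (\sum_(y <- t) y.1 ⊗ y.2) = \sum_(x <- v) x.1 ⊗ x.2.
    move=> /Hs[Sx [p hx1] [r hx2]].
    elim: t Ht {Eb} => [_|y t IHt Ht]; first by exists [::]; rewrite !big_nil mulr0.
    have [|v [Hv Ev]] := IHt; first by move=> w wt; apply: Ht; rewrite inE wt orbT.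
    have [Sy [p' hy1] [r' hy2]] := Ht y (mem_head _ _).
    (* The sign from moving [x.2] past [y.1] is absorbed into the left factor. *)
    exists (((-1) ^+ (p' && r) *: (x.1 * y.1), x.2 * y.2) :: v); split.
      move=> w; rewrite inE => /predU1P[->|/Hv//] /=; split.
      - exact: gen_subalgM.
      - by exists (p (+) p'); apply/homogZ/homogM.
      - by exists (r (+) r'); apply/homogM.
    by rewrite !big_cons mulrDr Ev (tens_mul _ _ hy1 hx2) tensZl.
  elim: s {Hs Ea} tensM => [_|x s IHs tensM]; first by exists [::]; rewrite !big_nil.
  have [|u [Hu Eu]] := IHs; first by move=> y ys; apply: tensM; rewrite inE ys orbT.
  have [v [Hv Ev]] := tensM x (mem_head _ _).
  exists (v ++ u); split; last by rewrite big_cons Eu Ev big_cat.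
  by move=> w; rewrite mem_cat => /orP[/Hv|/Hu].
- exists ([seq (c *: x.1, x.2) | x <- s] ++ t); split.
    move=> w; rewrite mem_cat => /orP[/mapP[x /Hs[Sx [p hx1] hx2] ->]|/Ht//].
    by split=> //; exists p; apply: homogZ.
  rewrite DeltaL Ea Eb big_cat big_map scaler_sumr; congr (_ + _).
  by apply: eq_bigr => x _; rewrite tensZl.
Qed.

Lemma Bsub_left_coideal dp dm : left_coideal (Bsub q dp dm).
Proof.
have kh := kk_homog q; have Vh := kkV_homog q; have xh := xi_homog q.
have oh := one_homog q; have hkk := homogM (kh (node 0)) (Vh (node 1)).
have hx s : homog true (xi q s 1 * k0) := homogM (xh _ _) (kh _).
have hx' i : homog true (xi' q i * k0) := homogM (homogM (Vh _) (xh _ _)) (kh _).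
have hxm : homog true (xi q false 0 * k0) := homogM (xh _ _) (kh _).
have hB0p : homog true (B0p q dp).
  by rewrite /B0p -scaleNr; apply: homogD; [apply: hx'|apply/homogZ/hx].
have hB0m : homog true (B0m q dm).
  by rewrite /B0m -scaleNr; apply: homogD; [apply: hxm|apply/homogZ/hx'].
apply: homog_coideal_gen_subalg; set G := (G in gen_subalg G) => b.
have G1 : gen_subalg G (k0 * k1V) by apply: gen_subalg_in; apply: Or42.
case=> ->.
- exists [:: (kk q ord_max, kk q ord_max)]; rewrite big_seq1 Delta_kk.
  split=> // x; rewrite inE => /eqP->; split; try by exists false; apply: kh.
  by apply: gen_subalg_in; apply: Or41.
- exists [:: (k0 * k1V, k0 * k1V)]; rewrite big_seq1 DeltaM Delta_kk Delta_kkV.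
  rewrite (tens_mul_evenl _ _ (Vh _) (kh _)); split=> // x; rewrite inE => /eqP->.
  by split=> //; exists false; apply: hkk.
- exists [:: (xi' q 0 * k0, 1); (k0, B0p q dp);
    (- dp *: (xi q false 1 * k0), k0 * k1V)]; split; last first.
    by rewrite Delta_B0p !big_cons big_nil addr0 tensZl scaleNr addrA.
  move=> x; rewrite !inE => /or3P[]/eqP->; split=> //=.
  + exact: gen_subalg1.
  + by exists true; apply: hx'.
  + by exists false; apply: oh.
  + by apply: gen_subalg_in; apply: Or43.
  + by exists false; apply: kh.
  + by exists true.
  + by exists true; apply/homogZ/hx.
  + by exists false; apply: hkk.
- exists [:: (xi q false 0 * k0, 1); (k0, B0m q dm);
    (- dm *: (xi' q 1 * k0), k0 * k1V)]; split; last first.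
    by rewrite Delta_B0m !big_cons big_nil addr0 tensZl scaleNr addrA.
  move=> x; rewrite !inE => /or3P[]/eqP->; split=> //=.
  + exact: gen_subalg1.
  + by exists true.
  + by exists false; apply: oh.
  + by apply: gen_subalg_in; apply: Or44.
  + by exists false; apply: kh.
  + by exists true.
  + by exists true; apply/homogZ/hx'.
  + by exists false; apply: hkk.
Qed.

End Coideal.

(** * Diagonal and six-vertex matrices, and the reflection equation for them *)

Definition diag2 (L : fieldType) (a b : L) : 'M[L]_2 :=
  a *: delta_mx 0 0 + b *: delta_mx 1 1.

Lemma eq_mx2 (L : fieldType) (A B : 'M[L]_2) :
  A 0 0 = B 0 0 -> A 0 1 = B 0 1 -> A 1 0 = B 1 0 -> A 1 1 = B 1 1 -> A = B.
Proof.
move=> h00 h01 h10 h11.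
have i2 (i : 'I_2) : i = 0 \/ i = 1.
  by case: i => [[|[|[]]] ?] //; [left | right]; apply: val_inj.
by apply/matrixP=> a b; case: (i2 a) => ->; case: (i2 b) => ->.
Qed.

Lemma mulmx2E (L : fieldType) (A B : 'M[L]_2) i j :
  (A *m B) i j = A i 0 * B 0 j + A i 1 * B 1 j.
Proof.
rewrite mxE !big_ord_recl big_ord0 addr0; congr (_ + A i _ * B _ j);
  exact: val_inj.
Qed.

Section SixVertex.
Context (L : fieldType).

(** The operators that preserve the number of odd factors v_2; [b], [c], [d], [e] form the block on
    v_1 ⊗ v_2 and v_2 ⊗ v_1. *)
Definition six_vertex (a b c d e f : L) : 'M[L]_4 :=
  \matrix_(i, j) nth 0 (nth [::]
    [:: [:: a; 0; 0; 0];
        [:: 0; b; c; 0];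
        [:: 0; d; e; 0];
        [:: 0; 0; 0; f]] i) j.

(** [inord] does not compute on literal indices; this form and [snd4E] do. *)
Lemma fst4E k (hk : (k < 4)%N) : fst4 (Ordinal hk) = if (k < 2)%N then 0 else 1.
Proof.
rewrite /fst4 /=; apply: val_inj.
by case: k hk => [|[|[|[|]]]] //= _; rewrite inordK.
Qed.

Lemma snd4E k (hk : (k < 4)%N) : snd4 (Ordinal hk) = if odd k then 1 else 0.
Proof.
rewrite /snd4 /=; apply: val_inj.
by case: k hk => [|[|[|[|]]]] //= _; rewrite inordK.
Qed.

Lemma eq_mx4 (A B : 'M[L]_4) :
  (forall i j (hi : (i < 4)%N) (hj : (j < 4)%N),
     A (Ordinal hi) (Ordinal hj) = B (Ordinal hi) (Ordinal hj)) -> A = B.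
Proof. by move=> AB; apply/matrixP=> [[i hi] [j hj]]. Qed.

Lemma six_vertexM a b c d e f a' b' c' d' e' f' :
  six_vertex a b c d e f *m six_vertex a' b' c' d' e' f' =
  six_vertex (a * a') (b * b' + c * d') (b * c' + c * e')
    (d * b' + e * d') (d * c' + e * e') (f * f').
Proof.
apply: eq_mx4 => [] [|[|[|[|//]]]] [|[|[|[|//]]]] hi hj;
  rewrite !mxE !big_ord_recl big_ord0 !mxE /=;
  by rewrite !(mul0r, mulr0, addr0, add0r).
Qed.

Lemma grflipE : grflip L = six_vertex 1 0 1 1 0 (-1).
Proof.
by apply: eq_mx4 => [] [|[|[|[|//]]]] [|[|[|[|//]]]] hi hj;
  rewrite !mxE !fst4E !snd4E.
Qed.

Lemma R12E q x : let r := (x - 1) / (q * x - q^-1) in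
  R12 q x = six_vertex 1 r (1 - q * r) (1 - r / q) r (-1 + (q + q^-1) * r).
Proof. by []. Qed.

(** Conjugation by the flip exchanges the two middle basis vectors, and its sign on v_2 ⊗ v_2 occurs
    twice and cancels. *)
Lemma R21E q x : let r := (x - 1) / (q * x - q^-1) in
  R21 q x = six_vertex 1 r (1 - r / q) (1 - q * r) r (-1 + (q + q^-1) * r).
Proof.
move=> r; rewrite /R21 grflipE -[Rmx q x]/(R12 q x) R12E -/r !six_vertexM.
by congr six_vertex; ring.
Qed.

(** A diagonal matrix is even, so the graded tensor product contributes no sign. *)
Lemma K1E a b : K1 (diag2 a b) = six_vertex a a 0 0 b b.
Proof.
by rewrite /K1; apply: eq_mx4 => [] [|[|[|[|//]]]] [|[|[|[|//]]]] hi hj;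
  rewrite !mxE !fst4E !snd4E /=; ring.
Qed.

Lemma K2E a b : K2 (diag2 a b) = six_vertex a b 0 0 a b.
Proof.
by rewrite /K2; apply: eq_mx4 => [] [|[|[|[|//]]]] [|[|[|[|//]]]] hi hj;
  rewrite !mxE !fst4E !snd4E /=; ring.
Qed.

(** The four diagonal entries agree by commutativity for any diagonal [kz] and [kw]; their precise
    form matters off the diagonal. The last two hypotheses keep the denominators of R(z/w) and R(zw)
    nonzero. *)
Lemma diag2_reflection (q z w c : L) (kz kw : 'M[L]_2) :
  kz = diag2 (z * (z - c)) (1 - c * z) ->
  kw = diag2 (w * (w - c)) (1 - c * w) ->
  q != 0 -> w != 0 -> q ^+ 2 * z != w -> q ^+ 2 * (z * w) != 1 ->
  R21 q (z / w) *m K1 kz *m R12 q (z * w) *m K2 kw =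
  K2 kw *m R21 q (z * w) *m K1 kz *m R12 q (z / w).
Proof.
move=> -> -> q0 w0 d1 d2; rewrite !R21E !R12E !K1E !K2E !six_vertexM.
have D1 : q ^+ 2 * z - w != 0 by rewrite subr_eq0.
have D2 : q ^+ 2 * (z * w) - 1 != 0 by rewrite subr_eq0.
(* Expanding by [q * w] here, and by [q] in [e2], turns the denominators into those of [D1] and
   [D2]. *)
have e1 : (z / w - 1) / (q * (z / w) - q^-1) = q * (z - w) / (q ^+ 2 * z - w).
  by field; rewrite q0 w0 D1.
have e2 : (z * w - 1) / (q * (z * w) - q^-1) =
    q * (z * w - 1) / (q ^+ 2 * (z * w) - 1).
  by field; rewrite q0 D2.
rewrite e1 e2 {e1 e2 d1 d2}; congr six_vertex; try ring; by field; rewrite q0 D1 D2.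
Qed.

End SixVertex.

(** * Substitution of z and w into rational functions *)

Section RationalSubstitution.
Context (K : fieldType).
Local Notation Kzw := (ratfun2 K).
Local Notation at_ x p := (map_poly (constzw K) p).[x].

Lemma tofrac_inj (D : idomainType) : injective (@tofrac D).
Proof. by move=> x y /eqP; rewrite tofrac_eq => /eqP. Qed.

Lemma constzw_horner (y : {poly {poly K}}) (p : {poly K}) :
  at_ (tofrac y) p = tofrac (map_poly (polyC \o polyC) p).[y].
Proof. by rewrite -horner_map -map_poly_comp. Qed.

(** z is the inner variable of K[z][w], so p(z) is constant in the outer one; for w, the
    coefficients of p become the constants instead. *)
Lemma zvar_horner p : at_ (zvar K) p = tofrac (p%:P).
Proof.
rewrite constzw_horner map_poly_comp horner_map /=; congr (tofrac (_%:P)).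
by rewrite -/(p \Po 'X) comp_polyXr.
Qed.

Lemma wvar_horner p : at_ (wvar K) p = tofrac (map_poly polyC p).
Proof.
rewrite constzw_horner map_poly_comp; congr tofrac.
by rewrite -/(_ \Po 'X) comp_polyXr.
Qed.

(** The representative chosen for [tofrac p] need not be p/1, but its numerator is p times its
    denominator, and the latter cancels since it does not vanish at [x]. *)
Lemma rat_subst_poly (x : Kzw) (p : {poly K}) :
  (forall d : {poly K}, d != 0 -> at_ x d != 0) ->
  rat_subst x (tofrac p) = at_ x p.
Proof.
move=> x_transc; rewrite /rat_subst; set f := tofrac p.
have nd : \n_(repr f) = p * \d_(repr f).
  have -> : f = \pi_{fraction {poly K}}%qT (Ratio p 1).
    by rewrite /f; unlock FracField.tofrac.
  have := equivf_l (Ratio p 1).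
  by rewrite !numden_Ratio ?oner_eq0 // mulr1 mulrC.
rewrite nd rmorphM hornerM mulfK //; apply: x_transc; exact: denom_ratioP.
Qed.

Lemma zvar_transc (d : {poly K}) : d != 0 -> at_ (zvar K) d != 0.
Proof. by rewrite zvar_horner tofrac_eq0 polyC_eq0. Qed.

Lemma wvar_transc (d : {poly K}) : d != 0 -> at_ (wvar K) d != 0.
Proof. by rewrite wvar_horner tofrac_eq0 map_polyC_eq0. Qed.

End RationalSubstitution.

(* An evaluation is kept abstract below: unification is too slow on terms that
   expose [eval_rep_counit] and [Delta]. *)
Definition evaluation_at (K F : fieldType) (iota : {rmorphism K -> F}) (q : K)
    (z : F) (f : Uq q -> 'M[F]_2) : Prop :=
  alg_morph (scalar_mx \o iota) f /\
  forall g, f (pgen (Uq_rel q) g) = T_gen iota q z g.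

(** * Action of the generators of [Bsub] under evaluation *)

Section Evaluation.
Context (K F : fieldType) (iota : {rmorphism K -> F}) (q : K) (z : F).
Hypothesis q_neq0 : q != 0.
Hypothesis z_neq0 : z != 0.
Context (f : Uq q -> 'M[F]_2).
Hypothesis fP : evaluation_at iota z f.

Let q0 : iota q != 0. Proof. by rewrite fmorph_eq0. Qed.

Let fM a b : f (a * b) = f a * f b. Proof. by have [[_ -> _] _] := fP. Qed.

Let fBZ c a b : f (a - c *: b) = f a - iota c *: f b.
Proof.
by rewrite (alg_morphB fP.1) (alg_morphZ fP.1); congr (_ - _);
  apply: mul_scalar_mx.
Qed.

Let f_kk i : f (kk q i) = T_k (iota q) i. Proof. exact: (fP.2 (Kg i)). Qed.
Let f_kkV i : f (kkV q i) = T_k (iota q)^-1 i. Proof. exact: (fP.2 (Kinv i)). Qed.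
Let f_xi s i : f (xi q s i) = T_gen iota q z (Xi s i).
Proof. exact: (fP.2 (Xi s i)). Qed.

Lemma evaluation_k2 : f (kk q ord_max) = diag2 (iota q) (iota q)^-1.
Proof. by rewrite f_kk. Qed.

Lemma evaluation_k0k1V : f (kk q (node 0) * kkV q (node 1)) = (iota q ^- 2)%:M.
Proof.
rewrite fM f_kk f_kkV.
by apply: eq_mx2; rewrite !(mulmx2E, mxE) /=; field.
Qed.

(** As k_0 acts by the scalar 1/q, the two terms act by z e_21 and (d_+ / q) e_21; this explains the
    parametrisation d_+ = q c. *)
Lemma evaluation_B0p c : f (B0p q (q * c)) = (z - iota c) *: delta_mx 1 0.
Proof.
rewrite /B0p /xi' fBZ !fM !f_kk !f_kkV !f_xi rmorphM /T_k /=.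
by apply: eq_mx2; rewrite !(mulmx2E, mxE) /= invrK; field.
Qed.

Lemma evaluation_B0m c :
  f (B0m q (- (q * c))) = ((iota c - z^-1) / iota q) *: delta_mx 0 1.
Proof.
rewrite /B0m /xi' fBZ !fM !f_kk !f_kkV !f_xi rmorphN rmorphM /T_k /=.
by apply: eq_mx2; rewrite !(mulmx2E, mxE) /=; field; rewrite q0 z_neq0.
Qed.

End Evaluation.

(** * Existence and uniqueness of the intertwiner between evaluations at z and 1/z *)

Section Intertwiner.
Context (K F : fieldType) (iota : {rmorphism K -> F}) (q c : K) (z : F).
Hypothesis q_neq0 : q != 0.
Hypothesis z_neq0 : z != 0.
Context (f g : Uq q -> 'M[F]_2).
Hypothesis fP : evaluation_at iota z f.
Hypothesis gP : evaluation_at iota z^-1 g.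
Local Notation B := (Bsub q (q * c) (- (q * c))).

Let q0 : iota q != 0. Proof. by rewrite fmorph_eq0. Qed.
Let V0 : z^-1 != 0. Proof. by rewrite invr_eq0. Qed.

Lemma singlet_intertwiner b : B b ->
  let M := diag2 (z * (z - iota c)) (1 - iota c * z) in
  g b *m M = M *m f b.
Proof.
move=> Bb M; have [[f1 fM fL] _] := fP; have [[g1 gM gL] _] := gP.
elim: Bb => {b} [b||a b _ IHa _ IHb|x a b _ IHa _ IHb].
- case=> ->.
  + rewrite (evaluation_k2 fP) (evaluation_k2 gP); apply: eq_mx2;
      by rewrite !(mulmx2E, mxE) /=; ring.
  + by rewrite (evaluation_k0k1V q_neq0 fP) (evaluation_k0k1V q_neq0 gP) scalar_mxC.
  (* The nontrivial entry is (1/z - c) z (z - c) = (1 - c z) (z - c). *)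
  + rewrite (evaluation_B0p q_neq0 fP) (evaluation_B0p q_neq0 gP); apply: eq_mx2;
      by rewrite !(mulmx2E, mxE) /=; field.
  + rewrite (evaluation_B0m q_neq0 z_neq0 fP) (evaluation_B0m q_neq0 V0 gP) invrK.
    by apply: eq_mx2; rewrite !(mulmx2E, mxE) /=; field; rewrite ?q0 ?z_neq0.
- by rewrite f1 g1 mulmx1 mul1mx.
- by rewrite fM gM -[LHS]mulmxA IHb mulmxA IHa -mulmxA.
rewrite fL gL /= [LHS]mulmxDl [RHS]mulmxDr IHb; congr (_ + _).
by rewrite -[LHS]mulmxA IHa !mulmxA scalar_mxC.
Qed.

(** Division by q - 1/q kills the off-diagonal entries, and division by z - c expresses [M 1 1]
    through [M 0 0]. The scalar is read off at entry (0, 0). *)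
Lemma singlet_intertwiner_unique (M : 'M[F]_2) :
  iota q - (iota q)^-1 != 0 -> z - iota c != 0 ->
  (forall b, B b -> g b *m M = M *m f b) ->
  M = (M 0 0 / (z * (z - iota c))) *: diag2 (z * (z - iota c)) (1 - iota c * z).
Proof.
move=> qq zc HM.
have Hk2 : diag2 (iota q) (iota q)^-1 *m M = M *m diag2 (iota q) (iota q)^-1.
  rewrite -{1}(evaluation_k2 gP) -(evaluation_k2 fP).
  by apply: HM; apply: gen_subalg_in; apply: Or41.
have HB : (z^-1 - iota c) *: delta_mx 1 0 *m M =
    M *m ((z - iota c) *: delta_mx 1 0).
  rewrite -(evaluation_B0p q_neq0 gP) -(evaluation_B0p q_neq0 fP).
  by apply: HM; apply: gen_subalg_in; apply: Or43.
have M01 : M 0 1 = 0.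
  have /matrixP/(_ 0 1)/eqP := Hk2; rewrite !mulmx2E !mxE /= -subr_eq0 => /eqP E.
  by apply: (mulfI qq); rewrite mulr0 -E; ring.
have M10 : M 1 0 = 0.
  (* The sides are swapped so that their difference is (q - 1/q) times [M 1 0], with the sign that
     [qq] needs. *)
  have /matrixP/(_ 1 0)/esym/eqP := Hk2.
  rewrite !mulmx2E !mxE /= -subr_eq0 => /eqP E.
  by apply: (mulfI qq); rewrite mulr0 -E; ring.
have M11 : M 1 1 * (z - iota c) = (z^-1 - iota c) * M 0 0.
  have /matrixP/(_ 1 0) := HB; rewrite !mulmx2E !mxE /=.
  by rewrite !(mulr0, mulr1, mul0r, addr0, add0r) => ->.
apply: eq_mx2; rewrite ?M01 ?M10 !mxE /=.
- by field; rewrite z_neq0 zc.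
- by rewrite !mulr0 addr0 mulr0.
- by rewrite !mulr0 addr0 mulr0.
- by apply: (mulIf zc); rewrite M11; field; rewrite z_neq0 zc.
Qed.

End Intertwiner.

(** * Evaluation of the coproduct through the counit *)

Section EvaluationOfDelta.
Context (K F : fieldType) (iota : {rmorphism K -> F}) (q : K) (z : F).
Hypothesis q_neq0 : q != 0.
Hypothesis q2_neq1 : q - q^-1 != 0.
Hypothesis z_neq0 : z != 0.
Local Notation eval_Delta b := (eval_rep_counit (q := q) iota z (Delta b)).
Local Notation hF := (scalar_mx \o iota : K -> 'M[F]_2).

Let hC c (s : 'M[F]_2) : hF c * s = s * hF c.
Proof. exact/comm_scalar_mx. Qed.

Lemma counit_pgen g : counit (pgen (Uq_rel q) g) = counit_gen K g.
Proof. exact: (pres_eval_gen (fun c t => mulrC _ _) (counit_rel (q:=q)) g). Qed.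

Lemma eval_rep_pgen g :
  eval_rep (q := q) iota z (pgen (Uq_rel q) g) = T_gen iota q z g.
Proof. exact: (pres_eval_gen hC (T_rel iota q_neq0 q2_neq1 z_neq0)). Qed.

Lemma eval_Delta_morph : alg_morph hF (fun b : Uq q => eval_Delta b).
Proof.
have [[P1 PM PL] _] := eval_rep_counit_morph iota q_neq0 q2_neq1 z_neq0.
have [D1 DM DL] := Delta_morph q; split.
- by rewrite D1 P1.
- by move=> a b; rewrite DM PM.
by move=> c a b; rewrite DL /pres_const -pres_scaleAl mul1r PL.
Qed.

(** This is the counit axiom on generators: epsilon kills the term with xi on the right and sends
    each k_i to 1. *)
Lemma eval_Delta_pgen g : eval_Delta (pgen (Uq_rel q) g) = T_gen iota q z g.
Proof.
have [PhiM Pt] := eval_rep_counit_morph iota q_neq0 q2_neq1 z_neq0.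
have [P1 _ _] := eval_rep_morph iota q_neq0 q2_neq1 z_neq0.
have [e1 _ _] := counit_morph q.
have PD := alg_morphD PhiM.
have Dg : Delta (pgen (Uq_rel q) g) = Delta_gen q g :=
  pres_eval_gen (@pres_const_central _ _ _) (@Delta_rel K q) g.
rewrite /= Dg; case: g {Dg} => [[] i|i|i] /=.
- by rewrite PD !Pt e1 !counit_pgen !eval_rep_pgen /= rmorph1 rmorph0 mulr1
    rmorph0 mulr0 addr0.
- by rewrite PD !Pt P1 !counit_pgen !eval_rep_pgen /= rmorph1 rmorph0 mulr1
    rmorph0 mulr0 addr0.
- by rewrite !Pt !counit_pgen !eval_rep_pgen /= rmorph1 mulr1.
- by rewrite !Pt !counit_pgen !eval_rep_pgen /= rmorph1 mulr1.
Qed.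

Lemma eval_Delta_evaluation : evaluation_at iota z (fun b : Uq q => eval_Delta b).
Proof. by split; [apply: eval_Delta_morph | apply: eval_Delta_pgen]. Qed.

End EvaluationOfDelta.

(** * The K-matrix over K(z) and the theorem *)

Section SingletBoundary.
Context (K : fieldType) (q c : K).
Hypothesis q_neq0 : q != 0.
Hypothesis q2_neq1 : q ^+ 2 != 1.
Local Notation z := (varz K).
Local Notation cz := (constz K).

(** This scalar multiple has polynomial entries, so that [rat_subst_poly] applies to them. *)
Definition singlet_K : 'M[ratfun K]_2 :=
  diag2 (z * (z - cz c)) (1 - cz c * z).

Lemma varz_neq0 : z != 0.
Proof. by rewrite tofrac_eq0 polyX_eq0. Qed.

Lemma singlet_K00E : z * (z - cz c) = tofrac ('X * ('X - c%:P)).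
Proof. by rewrite tofracM tofracB. Qed.

Lemma singlet_K11E : 1 - cz c * z = tofrac (1 - c%:P * 'X).
Proof. by rewrite tofracB tofracM tofrac1. Qed.

Lemma varz_sub_neq0 : z - cz c != 0.
Proof. by rewrite -[z - _]tofracB tofrac_eq0 polyXsubC_eq0. Qed.

Lemma singlet_K11_neq0 : 1 - cz c * z != 0.
Proof.
(* At z = 0 the polynomial takes the value 1 for every [c]. *)
rewrite singlet_K11E tofrac_eq0; apply/eqP => /(congr1 (horner^~ 0)) /eqP.
by rewrite !hornerE subr0 oner_eq0.
Qed.

Lemma singlet_K_neq0 : singlet_K != 0.
Proof.
apply/eqP => /matrixP/(_ 1 1); rewrite !mxE /= => /eqP.
by rewrite mulr0 mulr1 add0r (negPf singlet_K11_neq0).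
Qed.

Let q2 : q - q^-1 != 0.
Proof.
apply: contra q2_neq1 => /eqP/(congr1 ( *%R q))/eqP.
by rewrite mulrBr mulfV // mulr0 subr_eq0.
Qed.

Let fP := eval_Delta_evaluation cz q_neq0 q2 varz_neq0.
Let V0 : z^-1 != 0. Proof. by rewrite invr_eq0 varz_neq0. Qed.
Let gP := eval_Delta_evaluation cz q_neq0 q2 V0.

Lemma singlet_K_intertwines :
  intertwines (Bsub q (q * c) (- (q * c))) singlet_K.
Proof. exact: (singlet_intertwiner q_neq0 varz_neq0 fP gP). Qed.

Lemma intertwines_singlet (M : 'M[ratfun K]_2) :
  intertwines (Bsub q (q * c) (- (q * c))) M -> exists a, M = a *: singlet_K.
Proof.
move=> HM; eexists.
apply: (singlet_intertwiner_unique q_neq0 varz_neq0 fP gP) HM.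
  by rewrite -fmorphV -rmorphB fmorph_eq0.
exact: varz_sub_neq0.
Qed.

Lemma singlet_K_reflection : reflection_eq q singlet_K.
Proof.
have tE (x : ratfun2 K) :
    (forall d, d != 0 -> (map_poly (constzw K) d).[x] != 0) ->
  map_mx (rat_subst x) singlet_K =
    diag2 (x * (x - constzw K c)) (1 - constzw K c * x).
  move=> tx; rewrite /singlet_K singlet_K00E singlet_K11E.
  (* [rat_subst] evaluates a chosen fraction, so the zero entries too go through their polynomial
     form. *)
  have s0 : rat_subst x 0 = 0.
    by rewrite -[0 in LHS]tofrac0 rat_subst_poly // rmorph0 horner0.
  apply: eq_mx2; rewrite !mxE /= !(mulr0, mulr1, addr0, add0r) ?s0 //;
    rewrite rat_subst_poly //.
    by rewrite rmorphM rmorphB /= map_polyX map_polyC !hornerE.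
  by rewrite rmorphB rmorphM rmorph1 /= map_polyX map_polyC !hornerE.
have Ez := tE _ (@zvar_transc K); have Ew := tE _ (@wvar_transc K).
rewrite /reflection_eq; apply: (diag2_reflection Ez Ew).
- by rewrite fmorph_eq0.
- by rewrite tofrac_eq0 polyX_eq0.
(* q^2 z is constant in w, so its coefficient of w^1 is 0, against 1 for w itself. *)
- rewrite -rmorphXn -[_ * _]tofracM -polyCM; apply/eqP => /tofrac_inj.
  by move/polyP/(_ 1%N)/eqP; rewrite coefC coefX eq_sym oner_eq0.
(* q^2 z w is divisible by w, so its constant coefficient in w is 0, not 1. *)
- rewrite -rmorphXn mulrA -[_ * zvar K]tofracM -[_ * wvar K]tofracM -polyCM.
  apply/eqP; rewrite -tofrac1 => /tofrac_inj/polyP/(_ 0%N)/eqP.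
  by rewrite coefMX coef1 eq_sym oner_eq0.
Qed.

End SingletBoundary.

Theorem proposition4p2 (R : realType) (q : R[i]) (q_neq0 : q != 0)
    (q_transcendental : ~ algebraicOver (ratr : rat -> R[i]) q)
    (c dp dm : R[i]) (dpE : dp = q * c) (dmE : - dm = q * c) :
  left_coideal (Bsub q dp dm) /\
  exists K : 'M[ratfun R[i]]_2,
    [/\ K != 0,
        intertwines (Bsub q dp dm) K,
        forall K', intertwines (Bsub q dp dm) K' -> exists a, K' = a *: K &
        reflection_eq q K].
Proof.
split; first exact: Bsub_left_coideal.
have {dmE} -> : dm = - (q * c) by rewrite -dmE opprK.
(* Otherwise q would be a root of X^2 - 1, hence algebraic. *)
have q2 : q ^+ 2 != 1.
  apply/eqP => q2; apply: q_transcendental; exists ('X^2 - 1).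
    by rewrite -size_poly_eq0 size_XnsubC.
  by rewrite rmorphB /= map_polyXn rmorph1 rootE !hornerE q2 subrr.
rewrite dpE; exists (singlet_K c); split.
- exact: singlet_K_neq0.
- exact: singlet_K_intertwines.
- by move=> K'; apply: intertwines_singlet.
exact: singlet_K_reflection.
Qed.
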